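(* Let $X$ be a positive random variable with support on an interval of $\mathbb{R}^+$, with finite, strictly positive mean $\mu_X$ and cumulative distribution function $F_X$. Then the Lorenz curve $L_X$ of $X$ determines $F_X$ up to a scale factor. That is, if $X$ and $Y$ are two such random variables with $L_X(u)=L_Y(u)$ for all $u\in[0,1]$, then there exists a constant $c>0$ such that $F_Y(x)=F_X(x/c)$ for all $x\in\mathbb{R}$.
   Context: For a random variable $X$ with cumulative distribution function $F_X$ supported in a subset of the non-negative reals, with $F_X(0)=0$ and finite positive mean $\mu_X=\mathbb{E}(X)$, the Lorenz curve of $X$ is $$L_X(u)=\frac{1}{\mu_X}\int_0^u F_X^{-1}(y)\,dy,\qquad 0\le u\le 1,$$ where $F_X^{-1}$ is the right-continuous inverse (quantile function): $F_X^{-1}(y)=\sup\{x:F_X(x)\le y\}$ for $0\le y<1$, and $F_X^{-1}(1)=\sup\{x:F_X(x)<1\}$. *)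

(* Defs.v *)
From HB Require Import structures.
From mathcomp Require Export all_boot all_order all_algebra.
From mathcomp Require Export all_classical all_reals all_analysis.

Set Implicit Arguments.
Unset Strict Implicit.
Unset Printing Implicit Defensive.

Import Order.TTheory GRing.Theory Num.Theory.

Local Open Scope classical_set_scope.
Local Open Scope ring_scope.
Local Open Scope ereal_scope.

(* Meaningful for 0 <= y <= 1. The value is extended-real because the one at 1
   is +oo when F does not reach 1. *)
Definition quantile (R : realType) (F : R -> \bar R) (y : R) : \bar R :=
  if (y < 1)%R then ereal_sup [set x%:E | x in [set x : R | F x <= y%:E]]
  else ereal_sup [set x%:E | x in [set x : R | F x < 1]].

Definition lorenz_curve d (T : measurableType d) (R : realType)
    (P : probability T R) (X : {RV P >-> R}) (u : R) : \bar R :=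
  ((fine 'E_P[X])^-1)%:E *
  \int[lebesgue_measure]_(y in `[0%R, u]) quantile (cdf X) y.

(* Positivity is almost sure (F_X(0) = 0), and the interval only has to carry
   the law of X: it need not be closed, nor equal to the topological support. *)
Definition positive_rv_on_interval d (T : measurableType d) (R : realType)
    (P : probability T R) (X : {RV P >-> R}) : Prop :=
  [/\ cdf X 0%R = 0,
      (exists I : interval R,
         [set` I] `<=` `[0%R, +oo[ /\ P (X @^-1` [set` I]) = 1),
      'E_P[X] < +oo &
      0 < 'E_P[X]].

(* Main.v *)
Require Import Defs.
From mathcomp Require Import all_boot all_order all_algebra.
From mathcomp Require Import all_classical all_reals all_analysis.
From mathcomp Require Import measurable_realfun.

(** Write [a = 1 / E X], [b = 1 / E Y] and [qX], [qY] for the two quantile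
functions. Equality of the Lorenz curves says that [a * qX] and [b * qY] have
the same integral over every [[0, u]]. Both are nondecreasing, so no
differentiation theorem is needed to compare them: for [0 <= y < z < 1], cancel
the (finite) integrals over [[0, y]] and bound those over []y, z]] by the
endpoint values to get

  [(z - y) * b * qY y <= (z - y) * a * qX z],

that is [b * qY y <= a * qX z] ([lorenz_le_quantile]). The shift from [y] to
[z] is harmless, because a quantile function determines its cdf [F] through the
sandwich, valid for [y < 1],

  [F x < y -> x < q y -> F x <= y]

(right continuity of [F] gives the first implication, [cdf_lt_quantile];
monotonicity gives the second, [lt_quantile]). Hence [F_Y x < y < z < 1] implies
[F_X ((b / a) * x) <= z], and letting [y] and [z] decrease to [F_Y x] yields
[F_X ((b / a) * x) <= F_Y x] ([lorenz_cdf_le]). Exchanging [X] and [Y] gives the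
reverse inequality, with scale factor [c = a / b = E Y / E X]. *)

Set Implicit Arguments.
Unset Strict Implicit.

Local Open Scope classical_set_scope.
Local Open Scope ring_scope.

Import Order.TTheory GRing.Theory Num.Theory.

Section nondecreasing_integral.
Local Open Scope ereal_scope.
Context (R : realType).
Implicit Types (f g : R -> \bar R) (y z : R).

Lemma nondecreasing_emeasurable f (D : set R) : measurable D ->
  {homo f : x y / (x <= y)%R >-> x <= y} -> measurable_fun D f.
Proof.
move=> mD f_nd.
apply: (measurability _ (ErealGenCInfty.measurableE R)).
move=> _ [_ [r ->] <-].
apply: measurableI => //; apply: is_interval_measurable => s t /=.
rewrite !in_itv/= !andbT => fs ft u /andP[su ut].
by rewrite in_itv/= andbT (le_trans fs)// f_nd.
Qed.

(** The boolean [b] covers both [[y, z]] and []y, z]]: the first is used to see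
that an initial integral is finite, the second to compare increments. *)
Lemma integral_itv_bounds f (b : bool) y z :
  {homo f : x y / (x <= y)%R >-> x <= y} -> 0 <= f y -> (y <= z)%R ->
  f y * (z - y)%:E
    <= \int[lebesgue_measure]_(t in [set` Interval (BSide b y) (BRight z)]) f t
    <= f z * (z - y)%:E.
Proof.
move=> f_nd fy0 yz.
have f_itv t : t \in Interval (BSide b y) (BRight z) -> f y <= f t <= f z.
  by rewrite in_itv => /andP[/lteifW yt tz]; rewrite !f_nd.
have -> : (z - y)%:E =
    lebesgue_measure ([set` Interval (BSide b y) (BRight z)] : set R).
  rewrite lebesgue_measure_itv/= lte_fin; case: ltP => //= zy.
  by rewrite (le_anti (introT andP (conj yz zy))) subrr.
rewrite -!integral_cst//; apply/andP; split; apply: ge0_le_integral => //.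
- exact: nondecreasing_emeasurable.
- by move=> t /f_itv /andP[].
- by move=> t /f_itv /andP[+ _]; exact: le_trans.
- exact: nondecreasing_emeasurable.
- by move=> t /f_itv /andP[].
Qed.

(** Nondecreasing functions are compared pointwise from their primitives, at the
price of moving the upper one strictly to the right; finiteness of [f y] makes
the integral over [[0, y]] finite, so that it can be cancelled. *)
Lemma le_of_eq_integral f g y z :
  {homo f : x y / (x <= y)%R >-> x <= y} ->
  {homo g : x y / (x <= y)%R >-> x <= y} ->
  0 <= f 0%R -> 0 <= g 0%R -> f y < +oo -> (0 <= y < z)%R ->
  (forall u, (0 <= u <= z)%R ->
    \int[lebesgue_measure]_(t in `[0%R, u]) f t =
    \int[lebesgue_measure]_(t in `[0%R, u]) g t) ->
  f y <= g z.
Proof.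
move=> f_nd g_nd f0 g0 fyoo /andP[y0 yz] fg.
have splitE h : {homo h : x y / (x <= y)%R >-> x <= y} -> 0 <= h 0%R ->
    \int[lebesgue_measure]_(t in `[0%R, z]) h t =
    \int[lebesgue_measure]_(t in `[0%R, y]) h t +
    \int[lebesgue_measure]_(t in `]y, z]) h t.
  move=> h_nd h0.
  rewrite (@itv_bndbnd_setU _ _ _ (BRight y)) ?bnd_simp ?(ltW yz)//.
  rewrite ge0_integral_setU//.
  - by apply: nondecreasing_emeasurable => //; exact: measurableU.
  - move=> t [|] /=; rewrite in_itv/= => /andP[yt _]; apply: (le_trans h0).
      exact: h_nd.
    by apply: h_nd; rewrite (le_trans y0)// ltW.
  - apply/disj_setPRL => t /=; rewrite !in_itv/= => /andP[+ _].
    by rewrite ltNge => /negP yt /andP[].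
have fin_y : \int[lebesgue_measure]_(t in `[0%R, y]) f t \is a fin_num.
  rewrite ge0_fin_numE; last first.
    apply: integral_ge0 => t /=; rewrite in_itv/= => /andP[t0 _].
    by rewrite (le_trans f0)// f_nd.
  apply: (@le_lt_trans _ _ (f y * (y - 0)%:E)).
    by have /andP[] := integral_itv_bounds true f_nd f0 y0.
  by apply: lte_mul_pinfty => //; [exact: (le_trans f0 (f_nd _ _ y0))|
    rewrite ge0_fin_numE// (le_trans f0 (f_nd _ _ y0))|rewrite ltry].
have := fg z; rewrite lexx (le_trans y0 (ltW yz)) => /(_ isT).
rewrite !splitE// -(fg y) ?y0 ?(ltW yz)// => /eqP.
rewrite eq_le => /andP[+ _]; rewrite leeD2lE// => fg_yz.
rewrite -(@lee_pmul2r _ (z - y)%:E) ?lte_fin ?subr_gt0//.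
have fy0 := le_trans f0 (f_nd _ _ y0); have gy0 := le_trans g0 (g_nd _ _ y0).
have /andP[f_ge _] := integral_itv_bounds false f_nd fy0 (ltW yz).
have /andP[_ g_le] := integral_itv_bounds false g_nd gy0 (ltW yz).
exact: le_trans f_ge (le_trans fg_yz g_le).
Qed.

End nondecreasing_integral.

Section quantile.
Local Open Scope ereal_scope.
Context (R : realType).
Implicit Types (F : R -> \bar R) (x y : R).

Lemma quantile_nondecreasing F :
  {homo quantile F : y z / (y <= z)%R >-> y <= z}.
Proof.
move=> y z yz; rewrite /quantile.
have [z1|z1] := ltP z 1%R.
  rewrite (le_lt_trans yz z1); apply: ereal_sup_le => _ [x Fx <-].
  by exists x => //; apply: (le_trans Fx); rewrite lee_fin.
case: ifPn => // y1; apply: ereal_sup_le => _ [x Fx <-].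
by exists x => //; apply: (le_lt_trans Fx); rewrite lte_fin.
Qed.

Lemma le_quantile F x y : (y < 1)%R -> F x <= y%:E -> x%:E <= quantile F y.
Proof.
by move=> y1 Fxy; rewrite /quantile y1; apply: ereal_sup_ubound; exists x.
Qed.

Lemma lt_quantile F x y : {homo F : x y / (x <= y)%R >-> x <= y} ->
  (y < 1)%R -> x%:E < quantile F y -> F x <= y%:E.
Proof.
move=> F_nd y1; rewrite /quantile y1 => /ereal_sup_gt[_ [x' Fx' <-]].
by rewrite lte_fin => /ltW xx'; exact: le_trans (F_nd _ _ xx') Fx'.
Qed.

End quantile.

Section cdf_quantile.
Local Open Scope ereal_scope.
Context d (T : measurableType d) (R : realType) (P : probability T R).
Variable X : {RV P >-> R}.

(** The strict conclusion comes from right continuity: [cdf X] is still below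
[y] at some [t > x]. *)
Lemma cdf_lt_quantile x y : (y < 1)%R -> cdf X x < y%:E ->
  x%:E < quantile (cdf X) y.
Proof.
move=> y1 Xxy.
have : \forall t \near x^'+, cdf X t < y%:E.
  exact: (@cdf_right_continuous _ _ _ _ X x) (open_ereal_lt' Xxy).
move=> /(filterI (nbhs_right_gt x))/filter_ex[t [xt Xty]].
by rewrite (@lt_le_trans _ _ t%:E) ?lte_fin//; apply: le_quantile => //; exact: ltW.
Qed.

(** The cdf tends to 1, so it exceeds [y] somewhere, and any such point bounds
the quantile. *)
Lemma quantile_cdf_lty y : (y < 1)%R -> quantile (cdf X) y < +oo.
Proof.
move=> y1.
have : \forall t \near +oo%R, y%:E < cdf X t.
  have y1' : y%:E < 1 by rewrite lte_fin.
  exact: (@cvg_cdfy1 _ _ _ _ X) (open_ereal_gt' y1').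
move=> /filter_ex[t yXt]; apply: (@le_lt_trans _ _ t%:E); last exact: ltry.
rewrite leNgt; apply/negP => /(lt_quantile (@cdf_nondecreasing _ _ _ _ X) y1).
by rewrite leNgt yXt.
Qed.

Lemma quantile_cdf0_ge0 : cdf X 0%R = 0 -> 0 <= quantile (cdf X) 0%R.
Proof. by move=> X0; apply: le_quantile; rewrite ?X0. Qed.

(** The normalising factor goes under the integral so that two Lorenz curves are
primitives of nondecreasing functions, as [le_of_eq_integral] requires. *)
Lemma lorenz_curveE u : cdf X 0%R = 0 -> (0 <= fine 'E_P[X])%R ->
  lorenz_curve X u = \int[lebesgue_measure]_(y in `[0%R, u])
    ((fine 'E_P[X])^-1%:E * quantile (cdf X) y).
Proof.
move=> X0 EX0; rewrite ge0_integralZl_EFin ?invr_ge0//.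
- move=> y /=; rewrite in_itv/= => /andP[y0 _].
  exact: (le_trans (quantile_cdf0_ge0 X0) (quantile_nondecreasing _ _)).
- by apply: nondecreasing_emeasurable => //; exact: quantile_nondecreasing.
Qed.

End cdf_quantile.

Section lorenz.
Local Open Scope ereal_scope.
Context d d' (T : measurableType d) (T' : measurableType d') (R : realType).
Context (P : probability T R) (Q : probability T' R).
Context (X : {RV P >-> R}) (Y : {RV Q >-> R}).
Let mX := fine 'E_P[X].
Let mY := fine 'E_Q[Y].

Lemma lorenz_le_quantile y z : cdf X 0%R = 0 -> cdf Y 0%R = 0 ->
  (0 < mX)%R -> (0 < mY)%R ->
  (forall u, (0 <= u <= 1)%R -> lorenz_curve X u = lorenz_curve Y u) ->
  (0 <= y < z)%R -> (z < 1)%R ->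
  mY^-1%:E * quantile (cdf Y) y <= mX^-1%:E * quantile (cdf X) z.
Proof.
move=> X0 Y0 mX0 mY0 XY /andP[y0 yz] z1.
have nd F (a : R) : (0 < a)%R ->
    {homo (fun y => a^-1%:E * quantile F y) : y z / (y <= z)%R >-> y <= z}.
  move=> a0 s t st; apply: lee_wpmul2l; last exact: quantile_nondecreasing.
  by rewrite lee_fin invr_ge0 ltW.
apply: (le_of_eq_integral (f := fun y => mY^-1%:E * quantile (cdf Y) y)
  (g := fun y => mX^-1%:E * quantile (cdf X) y)).
- exact: nd.
- exact: nd.
- by rewrite mule_ge0 ?lee_fin ?invr_ge0 ?(ltW mY0)// quantile_cdf0_ge0.
- by rewrite mule_ge0 ?lee_fin ?invr_ge0 ?(ltW mX0)// quantile_cdf0_ge0.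
- apply: lte_mul_pinfty; rewrite ?lee_fin ?invr_ge0 ?(ltW mY0)//.
  exact/quantile_cdf_lty/(lt_trans yz).
- by rewrite y0.
- move=> u /andP[u0 uz]; rewrite -!lorenz_curveE ?(ltW mX0) ?(ltW mY0)//.
  by rewrite XY// u0 (le_trans uz)// ltW.
Qed.

(** One half of the theorem; the other half is the same statement with [X] and
[Y] exchanged. *)
Lemma lorenz_cdf_le x : cdf X 0%R = 0 -> cdf Y 0%R = 0 ->
  (0 < mX)%R -> (0 < mY)%R ->
  (forall u, (0 <= u <= 1)%R -> lorenz_curve X u = lorenz_curve Y u) ->
  cdf X (mX / mY * x)%R <= cdf Y x.
Proof.
move=> X0 Y0 mX0 mY0 XY; rewrite leNgt; apply/negP.
have fin_cdf d1 (T1 : measurableType d1) (P1 : probability T1 R)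
    (Z : {RV P1 >-> R}) t : exists2 p : R, cdf Z t = p%:E & (0 <= p <= 1)%R.
  have := cdf_le1 Z t; have := cdf_ge0 Z t; case: (cdf Z t) => [p||]//.
  by rewrite !lee_fin => p0 p1; exists p => //; rewrite p0.
have [q Xq /andP[_ q1]] := fin_cdf _ _ _ X (mX / mY * x)%R.
have [p Yp /andP[p0 _]] := fin_cdf _ _ _ Y x.
rewrite Yp Xq lte_fin => pq.
(* Two levels strictly between [p = F_Y x] and the supposedly larger [q]: the
   comparison of quantiles needs [y < z], and [z < q] gives the contradiction. *)
have [py yq] := midf_lt pq; set y := ((p + q) / 2)%R in py yq.
have [yz zq] := midf_lt yq; set z := ((y + q) / 2)%R in yz zq.
have z1 := lt_le_trans zq q1.
have : x%:E < quantile (cdf Y) y.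
  by apply: cdf_lt_quantile; rewrite ?Yp ?lte_fin// (lt_trans yz).
have /(lorenz_le_quantile X0 Y0 mX0 mY0 XY) := z1.
move=> /(_ y); rewrite yz (le_trans p0 (ltW py)) => /(_ isT) QYX xQ.
suff /(lt_quantile (@cdf_nondecreasing _ _ _ _ X) z1) :
    (mX / mY * x)%:E < quantile (cdf X) z by rewrite Xq lee_fin leNgt zq.
rewrite -mulrA EFinM -lte_pdivlMl// (lt_le_trans _ QYX)//.
by rewrite EFinM lte_pmul2l// lte_fin invr_gt0.
Qed.

End lorenz.

Unset Implicit Arguments.
Set Strict Implicit.

Theorem proposition3p1 (R : realType)
  (d d' : measure_display) (T : measurableType d) (T' : measurableType d')
  (P : probability T R) (Q : probability T' R)
  (X : {RV P >-> R}) (Y : {RV Q >-> R})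
  (hX : positive_rv_on_interval X) (hY : positive_rv_on_interval Y)
  (hL : forall u : R, 0 <= u <= 1 -> lorenz_curve X u = lorenz_curve Y u) :
  exists2 c : R, 0 < c & forall x : R, cdf Y x = cdf X (x / c).
Proof.
have mean d1 (T1 : measurableType d1) (P1 : probability T1 R)
    (Z : {RV P1 >-> R}) : positive_rv_on_interval Z ->
    cdf Z 0 = 0%E /\ 0 < fine 'E_P1[Z].
  by case=> Z0 _ EZoo EZ0; split => //; apply: fine_gt0; rewrite EZ0.
have [X0 EX0] := mean _ _ _ _ hX; have [Y0 EY0] := mean _ _ _ _ hY.
set mX := fine 'E_P[X] in EX0; set mY := fine 'E_Q[Y] in EY0.
exists (mY / mX); first exact: divr_gt0.
move=> x; rewrite invf_div mulrC; apply/le_anti/andP; split.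
  rewrite -[x in cdf Y x](_ : mY / mX * (mX / mY * x) = x).
    by apply: lorenz_cdf_le => // u u01; rewrite hL.
  by rewrite mulrA -invf_div mulVf ?mul1r// mulf_neq0 ?invr_eq0 ?gt_eqF.
exact: lorenz_cdf_le.
Qed.
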